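(* Let $\Phi=(A;\{E_i\}_{i=0}^d;A^*;\{E^*_i\}_{i=0}^d)$ be a tridiagonal system on $V$ with $d\ge1$, eigenvalue sequence $\{\theta_i\}_{i=0}^d$ and dual eigenvalue sequence $\{\theta^*_i\}_{i=0}^d$. Let $\mathcal R,\mathcal L$ be the $\Phi$-split raising and lowering maps and $\{F_i\}_{i=0}^d$ the projections for the $\Phi$-split decomposition. For $0\le i,j\le d$ such that $j-i\ge2$, the following holds on $F_jV$: $$\begin{aligned}0&=\sum_{i\le s\le j}\theta_s\frac{\mathcal L^{s-i}}{(\theta^*_i-\theta^*_s)(\theta^*_i-\theta^*_{s-1})\cdots(\theta^*_i-\theta^*_{i+1})}\;\frac{\mathcal L^{j-s}}{(\theta^*_j-\theta^*_s)(\theta^*_j-\theta^*_{s+1})\cdots(\theta^*_j-\theta^*_{j-1})}\\&\quad+\sum_{\substack{i\le r\le d,\\ 0\le s\le j,\\ {r-s=1}}}\frac{\mathcal L^{r-i}}{(\theta^*_i-\theta^*_r)(\theta^*_i-\theta^*_{r-1})\cdots(\theta^*_i-\theta^*_{i+1})}\;\mathcal R\;\frac{\mathcal L^{j-s}}{(\theta^*_j-\theta^*_s)(\theta^*_j-\theta^*_{s+1})\cdots(\theta^*_j-\theta^*_{j-1})}.\end{aligned}$$ Here empty products equal $1$.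
   Context: Let $\mathbb F$ be a field and $V$ a nonzero finite-dimensional vector space over $\mathbb F$; $\mathrm{End}(V)$ is the algebra of $\mathbb F$-linear maps $V\to V$, with identity $I$. A tridiagonal pair on $V$ is an ordered pair $A,A^*\in\mathrm{End}(V)$ such that: (1) each of $A,A^*$ is diagonalizable; (2) there is an ordering $\{V_i\}_{i=0}^d$ of the eigenspaces of $A$ with $A^*V_i\subseteq V_{i-1}+V_i+V_{i+1}$ $(0\le i\le d)$, where $V_{-1}=V_{d+1}=0$; (3) there is an ordering $\{V^*_i\}_{i=0}^\delta$ of the eigenspaces of $A^*$ with $AV^*_i\subseteq V^*_{i-1}+V^*_i+V^*_{i+1}$ $(0\le i\le\delta)$, where $V^*_{-1}=V^*_{\delta+1}=0$; (4) there is no subspace $W\subseteq V$ with $W\ne0$, $W\ne V$, $AW\subseteq W$, $A^*W\subseteq W$. It is known that $d=\delta$. Orderings as in (2), (3) are called standard. For a diagonalizable map, the primitive idempotent attached to an eigenspace is the projection onto that eigenspace that vanishes on the other eigenspaces; an ordering of primitive idempotents is standard if the corresponding ordering of eigenspaces is. A tridiagonal system on $V$ is a sequence $\Phi=(A;\{E_i\}_{i=0}^d;A^*;\{E^*_i\}_{i=0}^d)$ where $A,A^*$ is a tridiagonal pair on $V$, $\{E_i\}$ is a standard ordering of the primitive idempotents of $A$, and $\{E^*_i\}$ is a standard ordering of the primitive idempotents of $A^*$. Let $\theta_i$ (resp. $\theta^*_i$) be the eigenvalue of $A$ (resp. $A^*$) for $E_i$ (resp. $E^*_i$); $\{\theta_i\}_{i=0}^d$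 and $\{\theta^*_i\}_{i=0}^d$ are the eigenvalue and dual eigenvalue sequences. Throughout $d\ge1$. $\Phi$-split decomposition: $U_i=(E^*_0V+\cdots+E^*_iV)\cap(E_iV+\cdots+E_dV)$ for $0\le i\le d$; it is known that $V=\sum_{i=0}^dU_i$ is a direct sum. $F_i\in\mathrm{End}(V)$ is the projection onto $U_i$ with $F_iU_j=0$ for $j\ne i$ (so $F_iV=U_i$). Define $\mathcal R=A-\sum_{i=0}^d\theta_iF_i$ (the $\Phi$-split raising map) and $\mathcal L=A^*-\sum_{i=0}^d\theta^*_iF_i$ (the $\Phi$-split lowering map). It is known that $\mathcal RF_iV\subseteq F_{i+1}V$, $\mathcal LF_iV\subseteq F_{i-1}V$ (with $F_{-1}V=F_{d+1}V=0$). *)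

(* Defs.v *)
From HB Require Import structures.
From mathcomp Require Import all_boot all_order all_algebra.

Set Implicit Arguments.
Unset Strict Implicit.
Unset Printing Implicit Defensive.

Import GRing.Theory.
Local Open Scope ring_scope.

Section TridiagonalSystems.
Variables (K : fieldType) (V : vectType K).
Implicit Types (A As P : 'End(V)) (U W : {vspace V}).

Definition diagonalizable_lfun A : Prop :=
  exists s : seq K, (\sum_(a <- s) passmx.leigenspace A a)%VS = fullv.

Definition is_eigenspace A U : Prop :=
  exists2 a : K, passmx.leigenvalue A a & U = passmx.leigenspace A a.

(* The eigenspaces of A, each listed exactly once. *)
Definition eigenspace_ordering d A (W : 'I_d.+1 -> {vspace V}) : Prop :=
  injective W /\ forall U, is_eigenspace A U <-> exists i, W i = U.

(* The sum over the indices k in {i-1, i, i+1} with 0 <= k <= d encodes the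
   convention W_(-1) = W_(d+1) = 0. *)
Definition standard_ordering d A As (W : 'I_d.+1 -> {vspace V}) : Prop :=
  eigenspace_ordering A W /\
  forall i, (As @: W i <= \sum_(k < d.+1 | (i <= k.+1)%N && (k <= i.+1)%N) W k)%VS.

Definition irreducible_pair A As : Prop :=
  ~ exists W, [/\ W != 0%VS, W != fullv, (A @: W <= W)%VS & (As @: W <= W)%VS].

Definition td_pair A As : Prop :=
  [/\ diagonalizable_lfun A /\ diagonalizable_lfun As,
      exists d, exists W : 'I_d.+1 -> {vspace V}, standard_ordering A As W,
      exists d, exists W : 'I_d.+1 -> {vspace V}, standard_ordering As A W &
      irreducible_pair A As].

Definition projection_onto P U : Prop :=
  limg P = U /\ forall u, u \in U -> P u = u.

Definition primitive_idempotent A U P : Prop :=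
  [/\ is_eigenspace A U, projection_onto P U &
      forall U', is_eigenspace A U' -> U' != U -> (P @: U')%VS = 0%VS].

Definition standard_idempotents d A As (E : 'I_d.+1 -> 'End(V)) : Prop :=
  exists2 W : 'I_d.+1 -> {vspace V}, standard_ordering A As W &
    forall i, primitive_idempotent A (W i) (E i).

Definition td_system d A (E : 'I_d.+1 -> 'End(V))
    As (Es : 'I_d.+1 -> 'End(V)) : Prop :=
  [/\ td_pair A As, standard_idempotents A As E &
      standard_idempotents As A Es].

(* For a primitive idempotent E i, the image E i V is nonzero, so this
   determines theta i as the eigenvalue of A attached to E i. *)
Definition eigenvalue_sequence d A (E : 'I_d.+1 -> 'End(V))
    (theta : 'I_d.+1 -> K) : Prop :=
  forall i, limg (E i) = passmx.leigenspace A (theta i).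

Definition split_space d (E Es : 'I_d.+1 -> 'End(V)) (i : 'I_d.+1) :
    {vspace V} :=
  ((\sum_(k < d.+1 | (k <= i)%N) limg (Es k)) :&:
   (\sum_(k < d.+1 | (i <= k)%N) limg (E k)))%VS.

(* Since V is the direct sum of the split spaces, these conditions determine
   the family F. *)
Definition split_projections d (E Es F : 'I_d.+1 -> 'End(V)) : Prop :=
  forall i, projection_onto (F i) (split_space E Es i) /\
    forall j, j != i -> (F i @: split_space E Es j)%VS = 0%VS.

(* At (A, theta) this is the raising map; at (As, thetas), the lowering map. *)
Definition split_map d A (theta : 'I_d.+1 -> K) (F : 'I_d.+1 -> 'End(V)) :
    'End(V) :=
  A - \sum_(i < d.+1) theta i *: F i.

(* MathComp has no canonical ring structure on 'End(V) for an abstract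
   vectType, hence this power for composition. *)
Definition lfun_exp P (n : nat) : 'End(V) := iter n (comp_lfun P) \1%VF.

(* (x_i - x_s)(x_i - x_(s-1)) ... (x_i - x_(i+1)) *)
Definition den_up d (x : 'I_d.+1 -> K) (i s : 'I_d.+1) : K :=
  \prod_(k < d.+1 | (i < k <= s)%N) (x i - x k).

(* (x_j - x_s)(x_j - x_(s+1)) ... (x_j - x_(j-1)) *)
Definition den_down d (x : 'I_d.+1 -> K) (j s : 'I_d.+1) : K :=
  \prod_(k < d.+1 | (s <= k < j)%N) (x j - x k).

End TridiagonalSystems.

(* Main.v *)
(* Since [R] raises and [L] lowers the split spaces [U_s], each [v] in [U_j]
   extends to the [As]-eigenvector [w = sum_s L^(j-s) v / den_down j s] of
   eigenvalue [thetas j].  Dually the map [G_i = sum_r L^(r-i) F_r / den_up i r]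
   satisfies [G_i As = thetas_i G_i], hence kills every eigenspace of [As] but
   the [i]-th.  As [A w] lies in the eigenspaces [j-1], [j], [j+1] of [As],
   [G_i (A w) = 0] once [j - i >= 2]; expanding [A] as [R + theta_s] on [U_s]
   gives the relation.  That the [U_s] span [V] follows from irreducibility:
   their sum is stable under both maps and contains the nonzero space [U_0]. *)

Require Import Defs.
From HB Require Import structures.
From mathcomp Require Import all_boot all_order all_algebra.

Set Implicit Arguments.
Unset Strict Implicit.
Unset Printing Implicit Defensive.

Import GRing.Theory.
Local Open Scope ring_scope.

(** * Eigenvectors, powers and images of linear maps *)

Section LinearMaps.
Variables (K : fieldType) (V : vectType K).
Implicit Types (P : 'End(V)) (a : K) (u : V).

Lemma mem_leigenspace P a u :
  (u \in passmx.leigenspace P a) = (P u == a *: u).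
Proof. by rewrite memv_ker !lfun_simp subr_eq0. Qed.

Lemma lfun_expS P n u : lfun_exp P n.+1 u = P (lfun_exp P n u).
Proof. by rewrite /lfun_exp iterS comp_lfunE. Qed.

Lemma lfun_expSr P n u : lfun_exp P n.+1 u = lfun_exp P n (P u).
Proof.
elim: n => [|n IHn]; first by rewrite lfun_expS !id_lfunE.
by rewrite lfun_expS IHn -lfun_expS.
Qed.

Lemma limg_subvP P (U W : {vspace V}) :
  reflect (forall u, u \in U -> P u \in W) (P @: U <= W)%VS.
Proof.
apply: (iffP subvP) => [PUW u Uu|PUW _ /memv_imgP[u Uu ->]]; last exact: PUW.
exact/PUW/memv_img.
Qed.

Lemma sumv_subset (I : finType) (P Q : pred I) (W : I -> {vspace V}) :
  {subset P <= Q} -> (\sum_(k | P k) W k <= \sum_(k | Q k) W k)%VS.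
Proof.
move=> PQ; apply/subv_sumP => k Pk.
by apply: (sumv_sup k) (subvv _); apply: PQ.
Qed.

End LinearMaps.

(** * Eigenspaces of one map of the pair, and how the other map moves them *)

Section StandardIdempotents.
Variables (K : fieldType) (V : vectType K) (d : nat) (A As : 'End(V)).
Variables (E : 'I_d.+1 -> 'End(V)) (theta : 'I_d.+1 -> K).
Hypothesis E_std : standard_idempotents A As E.
Hypothesis theta_eig : eigenvalue_sequence A E theta.

Lemma eigenvalue_sequence_inj : injective theta.
Proof.
case: E_std => W [[W_inj _] _] EW i k eq_th; apply: W_inj.
by case: (EW i) (EW k) => _ [<- _] _ [_ [<- _] _]; rewrite !theta_eig eq_th.
Qed.

Lemma limg_idempotent_neq0 i : limg (E i) != 0%VS.
Proof.
by case: E_std => W _ /(_ i)[[a nz_a W_a] [-> _] _]; rewrite W_a.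
Qed.

Lemma mem_limg_idempotent i u : (u \in limg (E i)) = (A u == theta i *: u).
Proof. by rewrite theta_eig mem_leigenspace. Qed.

Lemma sum_limg_idempotent :
  diagonalizable_lfun A -> (\sum_k limg (E k))%VS = fullv.
Proof.
case: E_std => W [[_ W_eig] _] EW [s sum_s].
apply/eqP; rewrite eqEsubv subvf /= -[X in (X <= _)%VS]sum_s.
elim/big_rec: _ => [|a U _ sU]; first exact: sub0v.
rewrite subv_add sU andbT.
(* The list [s] may contain scalars that are not eigenvalues; these contribute the zero space. *)
have [-> | nz_a] := eqVneq (passmx.leigenspace A a) 0%VS; first exact: sub0v.
have [|i Wi] := (W_eig (passmx.leigenspace A a)).1; first by exists a.
by apply: (sumv_sup i) => //; case: (EW i) => _ [-> _] _; rewrite Wi.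
Qed.

Lemma idempotent_tridiagonal i :
  (As @: limg (E i) <=
   \sum_(k < d.+1 | (i <= k.+1)%N && (k <= i.+1)%N) limg (E k))%VS.
Proof.
case: E_std => W [_ W_tri] EW.
have limgE k : limg (E k) = W k by case: (EW k) => _ [].
by rewrite limgE; under eq_bigr do rewrite limgE; apply: W_tri.
Qed.

(** [A - theta i] scales the component in [limg (E k)] by [theta k - theta i], so the [i]-th
    component drops out. *)
Lemma sum_limg_sub_eig (P : pred 'I_d.+1) i u :
  u \in (\sum_(k | P k) limg (E k))%VS ->
  A u - theta i *: u \in (\sum_(k | P k && (k != i)) limg (E k))%VS.
Proof.
case/memv_sumP => us us_E ->; rewrite scaler_sumr linear_sum /= -sumrB.
apply: memv_suml => k Pk.
have /eqP -> : A (us k) == theta k *: us k by rewrite -mem_limg_idempotent us_E.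
have [->|ne_ki] := eqVneq k i; first by rewrite subrr mem0v.
rewrite -scalerBl memvZ //; move: (us k) (us_E k Pk); apply/subvP.
by apply: (sumv_sup k) => //; rewrite Pk.
Qed.

Lemma sum_limg_tridiagonal (P Q : pred 'I_d.+1) u :
  (forall i k : 'I_d.+1,
     P i -> (i <= k.+1)%N -> (k <= i.+1)%N -> Q k) ->
  u \in (\sum_(k | P k) limg (E k))%VS ->
  As u \in (\sum_(k | Q k) limg (E k))%VS.
Proof.
move=> PQ; move: u; apply/limg_subvP; rewrite limg_sum.
apply/subv_sumP => i Pi; apply: subv_trans (idempotent_tridiagonal i) _.
by apply: sumv_subset => k /andP[]; apply: PQ.
Qed.

End StandardIdempotents.

(** * The split decomposition with its raising and lowering maps *)

Section SplitDecomposition.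
Variables (K : fieldType) (V : vectType K) (d : nat) (A As : 'End(V)).
Variables (E Es F : 'I_d.+1 -> 'End(V)) (theta thetas : 'I_d.+1 -> K).
Hypothesis Phi : td_system A E As Es.
Hypothesis theta_eig : eigenvalue_sequence A E theta.
Hypothesis thetas_eig : eigenvalue_sequence As Es thetas.
Hypothesis F_proj : split_projections E Es F.

(* Indexing by [nat] makes [U n = 0] for [n > d], the convention
   [U_(d+1) = 0] of the paper. *)
Let U (n : nat) : {vspace V} :=
  ((\sum_(k < d.+1 | (k <= n)%N) limg (Es k)) :&:
   (\sum_(k < d.+1 | (n <= k)%N) limg (E k)))%VS.

Let R := split_map A theta F.
Let L := split_map As thetas F.

Let E_std : standard_idempotents A As E. Proof. by case: Phi. Qed.
Let Es_std : standard_idempotents As A Es. Proof. by case: Phi. Qed.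

(** Allowing [n > d], where [U n = 0] forces [u = 0], lets this apply to [R u] even for [u] in the
    last split space. *)
Lemma split_projE (r : 'I_d.+1) n u :
  u \in U n -> F r u = if r == n :> nat then u else 0.
Proof.
have [lt_nd | le_dn] := ltnP n d.+1; last first.
  rewrite memv_cap => /andP[_]; rewrite big_pred0 ?memv0 => [/eqP->|k].
    by rewrite linear0 if_same.
  by apply/negbTE; rewrite -ltnNge (leq_trans (ltn_ord k)).
have [_ F_out] := F_proj r; have [[_ F_id] _] := F_proj r.
have [/esym eq_nr Uu | ne_rn Uu] := eqVneq (r : nat) n.
  by apply: F_id; rewrite eq_nr in Uu.
apply/eqP; rewrite -memv0 -(F_out (Ordinal lt_nd)) 1?eq_sym //.
exact: memv_img.
Qed.

Lemma split_mapE (B : 'End(V)) (x : 'I_d.+1 -> K) (i : 'I_d.+1) u :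
  u \in U i -> split_map B x F u = B u - x i *: u.
Proof.
move=> Uu; rewrite /split_map !lfun_simp (bigD1 i) //= lfun_simp.
rewrite (split_projE _ Uu) eqxx big1 ?addr0 // => k ne_ki.
by rewrite lfun_simp (split_projE _ Uu) ifN // scaler0.
Qed.

(** On [U i] the map [R] is [A - theta i]: the tridiagonal action of [A] extends the initial sum of
    [Es]-spaces by one step, while subtracting [theta i] removes [limg (E i)] from the final sum of
    [E]-spaces. For [i = d] this says [R u = 0]. *)
Lemma raising_split (i : 'I_d.+1) u : u \in U i -> R u \in U i.+1.
Proof.
move=> Uu; rewrite (split_mapE _ _ Uu).
move: Uu; rewrite !memv_cap => /andP[downu upu]; apply/andP; split.
  rewrite memvB ?memvZ //.
    apply: (sum_limg_tridiagonal Es_std _ downu) => k l le_ki _ le_lk.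
    exact: leq_trans le_lk _.
  by move: downu; apply/subvP/sumv_subset => k /leqW.
move: (sum_limg_sub_eig theta_eig i upu); apply/subvP/sumv_subset => k.
by case/andP=> le_ik ne_ki; rewrite unfold_in ltn_neqAle eq_sym ne_ki.
Qed.

Lemma lowering_split (i : 'I_d.+1) n u :
  i = n.+1 :> nat -> u \in U i -> L u \in U n.
Proof.
move=> def_i Uu; rewrite (split_mapE _ _ Uu).
move: Uu; rewrite !memv_cap => /andP[downu upu]; apply/andP; split.
  move: (sum_limg_sub_eig thetas_eig i downu); apply/subvP/sumv_subset => k.
  case/andP=> le_ki ne_ki.
  by rewrite unfold_in -ltnS -def_i ltn_neqAle ne_ki.
rewrite memvB ?memvZ //.
  apply: (sum_limg_tridiagonal E_std _ upu) => k l le_ik le_kl _.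
  by rewrite -ltnS -def_i (leq_trans le_ik).
move: upu; apply/subvP/sumv_subset => k.
by rewrite unfold_in def_i; apply: ltnW.
Qed.

Lemma lowering_split0 (i : 'I_d.+1) u : i = 0%N :> nat -> u \in U i -> L u = 0.
Proof.
move=> i0 Uu; rewrite (split_mapE _ _ Uu).
move: Uu; rewrite memv_cap => /andP[downu _].
have := sum_limg_sub_eig thetas_eig i downu.
rewrite big_pred0 ?memv0 => [/eqP //|k].
by rewrite i0 leqn0 -[0%N]i0 andbN.
Qed.

Lemma sum_split : (\sum_(i < d.+1) U i)%VS = fullv.
Proof.
have [[[A_diag As_diag] _ _ irr] _ _] := Phi.
have [//|neq_full] := eqVneq (\sum_(i < d.+1) U i)%VS fullv.
have stable (B : 'End(V)) (x : 'I_d.+1 -> K) :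
    (forall (i : 'I_d.+1) u, u \in U i ->
      split_map B x F u \in (\sum_(i < d.+1) U i)%VS) ->
    (B @: (\sum_(i < d.+1) U i) <= \sum_(i < d.+1) U i)%VS.
  move=> mapU; rewrite limg_sum; apply/subv_sumP => i _.
  apply/limg_subvP => u Uu.
  rewrite -[B u](subrK (x i *: u)) -(split_mapE _ _ Uu).
  rewrite memvD ?(mapU i) ?memvZ //.
  by move: u Uu; apply/subvP; apply: (sumv_sup i).
case: irr; exists (\sum_(i < d.+1) U i)%VS; split=> //.
(* [U 0] contains [limg (Es ord0)], since the spaces [limg (E k)] span everything. *)
- apply/eqP => sum0; case/eqP: (limg_idempotent_neq0 Es_std ord0); apply/eqP.
  rewrite -subv0 -sum0; apply: (sumv_sup ord0) => //.
  rewrite subv_cap (sumv_sup ord0) //=.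
  by rewrite (sum_limg_idempotent E_std A_diag) subvf.
- apply: (stable _ theta) => i u /raising_split; apply/subvP.
  have [lt_id | le_di] := ltnP i.+1 d.+1.
    exact: (sumv_sup (Ordinal lt_id)).
  rewrite /U [X in (_ :&: X)%VS]big_pred0 ?capv0 ?sub0v // => k.
  by apply/negbTE; rewrite -ltnNge (leq_trans (ltn_ord k)).
apply: (stable _ thetas) => i u Uu; case def_i: (i : nat) => [|n].
  by rewrite -/L (lowering_split0 def_i Uu) mem0v.
have lt_nd : (n < d.+1)%N by rewrite ltnW // -def_i.
have := lowering_split def_i Uu; apply/subvP.
exact: (sumv_sup (Ordinal lt_nd)).
Qed.

(** * Eigenvectors of [As] obtained from powers of [L] *)

Lemma lowering_exp_split (j : 'I_d.+1) m n u :
  j = (m + n)%N :> nat -> u \in U j -> lfun_exp L m u \in U n.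
Proof.
elim: m n => [|m IHm] n def_j Uu; first by rewrite id_lfunE -[n]add0n -def_j.
have lt_nd : (n.+1 < d.+1)%N.
  by rewrite (leq_ltn_trans _ (ltn_ord j)) // def_j addSnnS leq_addl.
rewrite lfun_expS; apply: (lowering_split (i := Ordinal lt_nd)) => //=.
by apply: IHm => //; rewrite addnS.
Qed.

Lemma dual_split (i : 'I_d.+1) u : u \in U i -> As u = thetas i *: u + L u.
Proof. by move=> Uu; rewrite /L (split_mapE _ _ Uu) addrC subrK. Qed.

(* The component in [U_s] of [Es_j v], for [v] in [U_j]. *)
Let term (j s : 'I_d.+1) (v : V) : V :=
  (den_down thetas j s)^-1 *: lfun_exp L (j - s) v.

Lemma term_split (j s : 'I_d.+1) v :
  v \in U j -> (s <= j)%N -> term j s v \in U s.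
Proof.
move=> Uv le_sj; apply: memvZ; apply: lowering_exp_split Uv.
by rewrite subnK.
Qed.

Lemma subr_thetas_neq0 (j s : 'I_d.+1) : (s < j)%N -> thetas j - thetas s != 0.
Proof.
apply: contraTneq => /subr0_eq.
by move/(eigenvalue_sequence_inj Es_std thetas_eig)=> ->; rewrite ltnn.
Qed.

(** Going from [s] down to [r] adds exactly the factor [thetas j - thetas r] to [den_down]. *)
Lemma lowering_term (j s r : 'I_d.+1) v :
  s = r.+1 :> nat -> (s <= j)%N ->
  L (term j s v) = (thetas j - thetas r) *: term j r v.
Proof.
move=> def_s le_sj; have lt_rj : (r < j)%N by rewrite -def_s.
rewrite linearZ /= -lfun_expS scalerA def_s -subSn ?subSS //.
congr (_ *: _); rewrite /den_down [in RHS](bigD1 r) ?leqnn //=.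
rewrite invfM mulrA divff ?subr_thetas_neq0 // mul1r; congr _^-1.
apply: eq_bigl => k; rewrite def_s [(r < k)%N]ltn_neqAle eq_sym.
by rewrite andbC andbA andbC -andbA.
Qed.

(** Applying [As - thetas j] to [term j s v] leaves a multiple of itself plus [L (term j s v)]; by
    [lowering_term] these contributions cancel between neighbouring indices. *)
Lemma dual_eigenvector (j : 'I_d.+1) v :
  v \in U j -> \sum_(s < d.+1 | (s <= j)%N) term j s v \in limg (Es j).
Proof.
move=> Uv; rewrite (mem_limg_idempotent thetas_eig) -subr_eq0.
(* The cutoff gives [y d.+1 = 0] and guards the default value of [inord]; [y 0 = 0] because [L]
   kills [U 0]. *)
pose y n := if (n <= j)%N then L (term j (inord n) v) else 0.
have telescope : \sum_(s < d.+1) (y s.+1 - y s) = 0.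
  rewrite -(big_mkord xpredT (fun s => y s.+1 - y s)) telescope_sumr //.
  have inord0 : inord 0 = ord0 :> 'I_d.+1 by apply: val_inj; rewrite /= inordK.
  rewrite {1}/y leqNgt ltn_ord /y /= inord0.
  by rewrite (lowering_split0 (i := ord0)) ?subr0 ?term_split.
rewrite linear_sum scaler_sumr -sumrB big_mkcond.
apply/eqP/oppr_inj; rewrite oppr0 -sumrN -[RHS]telescope /=.
apply: eq_bigr => s _; rewrite /y.
have [le_sj|lt_js] := leqP s j; last first.
  by rewrite ifN ?subr0 ?oppr0 // -ltnNge ltnW.
rewrite inord_val (dual_split (term_split Uv le_sj)) addrAC -scalerBl opprD.
congr (_ + _); rewrite -scaleNr opprB.
have [lt_sj|le_js] := ltnP s j.
  have lt_sd : (s.+1 < d.+1)%N by apply: leq_ltn_trans lt_sj _.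
  by rewrite (lowering_term (r := s)) ?inordK.
(* At the top index the cutoff matches the vanishing of [thetas j - thetas s]. *)
have -> : s = j by apply/val_inj/eqP; rewrite eqn_leq le_sj.
by rewrite subrr scale0r.
Qed.

(** * The dual construction: maps that detect a single eigenspace of [As] *)

Let coterm (i r : 'I_d.+1) : 'End(V) :=
  (den_up thetas i r)^-1 *: lfun_exp L (r - i).

(* [G i = F_i Es_i] *)
Let G (i : 'I_d.+1) : 'End(V) :=
  \sum_(r < d.+1 | (i <= r)%N) (coterm i r \o F r)%VF.

Lemma dual_functional_split (i r : 'I_d.+1) u :
  u \in U r -> G i u = if (i <= r)%N then coterm i r u else 0.
Proof.
move=> Uu; rewrite sum_lfunE; case: ifP => [le_ir|nle_ir].
  rewrite (bigD1 r) //= comp_lfunE (split_projE _ Uu) eqxx big1 ?addr0 //.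
  move=> k /andP[_ ne_kr].
  by rewrite comp_lfunE (split_projE _ Uu) ifN ?linear0.
rewrite big1 // => k le_ik.
rewrite comp_lfunE (split_projE _ Uu) ifN ?linear0 //.
by apply: contraFneq nle_ir => <-.
Qed.

(** On [U r] with [r > i], the coefficient of [L^(r-i)] is [thetas r / den_up i r + 1 / den_up i
    (r-1)]. Since [den_up i r] has the extra factor [thetas i - thetas r], this equals
    [thetas i / den_up i r]. *)
Lemma dual_functional_eig (i : 'I_d.+1) u : G i (As u) = thetas i *: G i u.
Proof.
have: u \in (\sum_(k < d.+1) U k)%VS by rewrite sum_split memvf.
case/memv_sumP => us Uus ->; rewrite !linear_sum /=.
apply: eq_bigr => r _; have Ur := Uus r isT; move: (us r) Ur => {}u Uu.
rewrite (dual_split Uu) linearD linearZ /= (dual_functional_split i Uu).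
case def_r: (r : nat) => [|n].
  rewrite (lowering_split0 def_r Uu) linear0 addr0 leqn0.
  case: eqP => [i0|_]; last by rewrite !scaler0.
  by rewrite (_ : r = i) //; apply: val_inj; rewrite /= def_r i0.
have lt_nd : (n < d.+1)%N by rewrite ltnW // -def_r.
pose q := Ordinal lt_nd.
rewrite (dual_functional_split (r := q) i (lowering_split def_r Uu)) /=.
(* With [r = n.+1]: for [i < r] both terms contribute, for [r < i] both vanish, and for [i = r] the
   map [G i] kills [L u], which lies in [U n]. *)
rewrite -[(i <= n)%N]ltnS; case: ltngtP => [lt_in|lt_ni|def_i]; last 2 first.
- by rewrite !scaler0 addr0.
- by rewrite addr0 (_ : r = i) //; apply: val_inj; rewrite /= def_r.
rewrite /coterm !scale_lfunE /= -lfun_expSr -subSn // -def_r !scalerA -scalerDl.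
congr (_ *: _).
have den_r : den_up thetas i r = (thetas i - thetas r) * den_up thetas i q.
  rewrite /den_up (bigD1 r) /= ?def_r ?leqnn ?andbT //; congr (_ * _).
  apply: eq_bigl => k; rewrite -[(k <= n)%N]ltnS -def_r [(k < r)%N]ltn_neqAle.
  by rewrite -andbA [X in _ && X]andbC.
have nz_ir : thetas i - thetas r != 0.
  by rewrite -opprB oppr_eq0 subr_thetas_neq0 // def_r.
by rewrite den_r invfM -[X in _ + X](mulVKf nz_ir) -mulrDl addrC subrK.
Qed.

Lemma dual_functional_vanish (i k : 'I_d.+1) u :
  k != i -> u \in limg (Es k) -> G i u = 0.
Proof.
move=> ne_ki; rewrite (mem_limg_idempotent thetas_eig) => /eqP eig_u.
have := dual_functional_eig i u; rewrite eig_u linearZ /= => /eqP.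
rewrite -subr_eq0 -scalerBl scaler_eq0 subr_eq0.
rewrite (inj_eq (eigenvalue_sequence_inj Es_std thetas_eig)).
by rewrite (negbTE ne_ki) => /eqP.
Qed.

Lemma dual_functional_tridiagonal (i j : 'I_d.+1) u :
  (i.+2 <= j)%N -> u \in limg (Es j) -> G i (A u) = 0.
Proof.
move=> lt_ij Eu.
have := (limg_subvP _ _ _ (idempotent_tridiagonal Es_std j)) u Eu.
case/memv_sumP => us us_E ->; rewrite linear_sum big1 // => k nkj.
apply: dual_functional_vanish (us_E k nkj).
apply: contraTneq lt_ij => <-; rewrite -leqNgt; by case/andP: nkj.
Qed.

(** This is [G i (A w) = 0] for the eigenvector [w] of [dual_eigenvector], expanded in the split
    spaces. *)
Lemma split_relation (i j : 'I_d.+1) v : (i.+2 <= j)%N -> v \in U j ->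
  \sum_(s < d.+1 | (i <= s <= j)%N) theta s *: coterm i s (term j s v) +
  \sum_(r < d.+1 | (i <= r)%N)
     \sum_(s < d.+1 | (s <= j)%N && (r == s.+1 :> nat))
        coterm i r (R (term j s v)) = 0.
Proof.
move=> lt_ij Uv.
rewrite -[RHS](dual_functional_tridiagonal lt_ij (dual_eigenvector Uv)).
rewrite !linear_sum /=.
(* With [s] as the outer index, both sides can be compared one component of [w] at a time. *)
rewrite (exchange_big_dep (fun s : 'I_d.+1 => s <= j)%N) /=; last first.
  by move=> r s _ /andP[].
rewrite (eq_bigl (fun s : 'I_d.+1 => (s <= j) && (i <= s))%N); last first.
  by move=> s; rewrite andbC.
rewrite big_mkcondr -big_split; apply: eq_bigr => s le_sj /=.
have Ux := term_split Uv le_sj.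
rewrite -[A _](subrK (theta s *: term j s v)) -(split_mapE _ _ Ux) -/R.
rewrite linearD [X in _ = _ + X]linearZ /= (dual_functional_split i Ux).
rewrite addrC; congr (_ + _).
  rewrite [in RHS]/G sum_lfunE.
  (* As [R] maps into [U s.+1], only [r = s.+1] survives in [G i]; for [s = d] there is no such [r]
     and the sum is empty. *)
  rewrite [in RHS](bigID (fun r : 'I_d.+1 => r == s.+1 :> nat)) /=.
  rewrite [X in _ = _ + X]big1 => [|r /andP[_ ne_rs]].
    rewrite addr0; apply: eq_big => r; first by rewrite le_sj.
    case/and3P=> _ _ eq_rs.
    by rewrite comp_lfunE (split_projE _ (raising_split Ux)) eq_rs.
  by rewrite comp_lfunE (split_projE _ (raising_split Ux)) ifN ?linear0.
by case: ifP => // _; rewrite scaler0.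
Qed.

End SplitDecomposition.

Theorem theorem9p1 (K : fieldType) (V : vectType K) (d : nat)
    (A As : 'End(V)) (E Es F : 'I_d.+1 -> 'End(V))
    (theta thetas : 'I_d.+1 -> K)
    (V_neq0 : (0 < \dim {:V})%N) (d_ge1 : (1 <= d)%N)
    (Phi : td_system A E As Es)
    (theta_eig : eigenvalue_sequence A E theta)
    (thetas_eig : eigenvalue_sequence As Es thetas)
    (F_proj : split_projections E Es F)
    (i j : 'I_d.+1) (le_ij : (i + 2 <= j)%N) :
  let R := split_map A theta F in
  let L := split_map As thetas F in
  forall v : V, v \in limg (F j) ->
  (\sum_(s < d.+1 | (i <= s <= j)%N)
      theta s *:
        (((den_up thetas i s)^-1 *: lfun_exp L (s - i)%N) \o
         ((den_down thetas j s)^-1 *: lfun_exp L (j - s)%N))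
   + \sum_(r < d.+1 | (i <= r)%N)
       \sum_(s < d.+1 | (s <= j)%N && (r == s.+1 :> nat))
        (((den_up thetas i r)^-1 *: lfun_exp L (r - i)%N) \o
         (R \o
         ((den_down thetas j s)^-1 *: lfun_exp L (j - s)%N))))%VF v = 0.
Proof.
move=> R L v Fv.
have Uv : v \in split_space E Es j.
  by case: (F_proj j) => [[<- _] _].
rewrite !lfun_simp.
have lt_ij : (i.+2 <= j)%N by rewrite -addn2.
rewrite -[RHS](split_relation Phi theta_eig thetas_eig F_proj lt_ij Uv).
congr (_ + _).
  by apply: eq_bigr => s _; rewrite !lfun_simp.
apply: eq_bigr => r _; rewrite lfun_simp; apply: eq_bigr => s _.
by rewrite !lfun_simp.
Qed.
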